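(* Let $k\ge 1$ be an integer. For every $n\in\mathbb N$ with $n\le k+2$, $|\mathcal D_{k,n}| = F_n-1$. For every integer $n\ge k+3$, $$|\mathcal D_{k,n}| = |\mathcal D_{k,n-1}|+|\mathcal D_{k,n-2}|-|\mathcal D_{k,n-k-2}|+\sum_{j=k+4}^{2k+3}|\mathcal D_{k,n-j}|,$$ with the convention that $|\mathcal D_{k,i}|=0$ if $i\le 0$.
   Context: $\mathbb N=\{1,2,3,\dots\}$, $[n]=\{1,2,\dots,n\}$, and $[a,b]$ is the set of all integers between $a$ and $b$ inclusive. A finite nonempty set $F\subset\mathbb N$ is called Schreier if $\min F\ge |F|$. For $k\in\mathbb N$, a set $F\subset\mathbb N$ is called $k$-neighbored if for every $a\in F$ there exists $b\in F\setminus\{a\}$ such that $|a-b|\le k$. For $k,n\in\mathbb N$, $\mathcal D_{k,n}:=\{F\subset[n] : n\in F,\ F\text{ is Schreier, and } F \text{ is } k\text{-neighbored}\}$. The numbers $F_n$ are the Fibonacci numbers: $F_1=F_2=1$ and $F_n=F_{n-1}+F_{n-2}$ for $n\ge 3$. *)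

(* Defs.v *)
From mathcomp Require Import all_boot all_order all_algebra.
From mathcomp Require Import finmap.

Set Implicit Arguments.
Unset Strict Implicit.
Unset Printing Implicit Defensive.

Import Order.TTheory GRing.Theory Num.Theory.
Local Open Scope fset_scope.

(* fib 0 = 0 is only there to start the recursion; it gives
   fib 1 = fib 2 = 1. *)
Fixpoint fib (n : nat) : nat :=
  match n with
  | 0 => 0
  | 1 => 1
  | (m.+1 as p).+1 => fib p + fib m
  end.

Definition is_min (F : {fset nat}) (m : nat) : bool :=
  (m \in F) && [forall a : F, m <= val a].

(* The existence of a minimum forces F to be nonempty. *)
Definition schreier (F : {fset nat}) : bool :=
  [exists m : F, is_min F (val m) && (#|` F| <= val m)].

Definition neighbored (k : nat) (F : {fset nat}) : bool :=
  [forall a : F, exists b : F,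
     (val b != val a) && (`|(val a)%:Z - (val b)%:Z| <= k%:Z)%R].

Definition interval1 (n : nat) : {fset nat} := [fset i in iota 1 n].

Definition D (k n : nat) : {fset {fset nat}} :=
  [fset F in fpowerset (interval1 n) |
     [&& n \in F, schreier F & neighbored k F]].

(* |D_{k,i}| for an integer index, with value 0 when i <= 0. *)
Definition cardD (k : nat) (i : int) : int :=
  if i is Posz n.+1 then #|` D k n.+1|%:Z else 0%R.

(* Main.v *)
(* Removing the maximum n of F and shifting the rest down by one is the key
   move: it lowers both the minimum and the cardinality by one, so it preserves
   the Schreier condition exactly.  Let E_m be defined as D_m, except that the
   maximum m itself need not have a neighbour.  With m + 1 the second largest
   element of F, the move gives a bijection from D_n to the disjoint union of
   the E_m, n - k - 1 <= m <= n - 2; and it splits E_n into {{n}}, D_n and a copy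
   of D_m for each m < n - k - 1.  Hence, for 0 < n,
     |D_{n+1}| - |D_n| = |E_{n-1}| - |E_{n-k-1}|,
     |E_n| = 1 + |D_n| + sum_(m < n-k-1) |D_m|,
   and eliminating E yields the recurrence. *)
Require Import Defs.
From mathcomp Require Import all_boot all_order all_algebra.
From mathcomp Require Import finmap zify.

Set Implicit Arguments.
Unset Strict Implicit.
Unset Printing Implicit Defensive.

Import Order.TTheory GRing.Theory Num.Theory.

(** * Elementwise descriptions of membership *)

Definition linked (k : nat) (F : {fset nat}) (a : nat) : Prop :=
  exists2 b, b \in F & [/\ b <> a, a <= b + k & b <= a + k].

(** Bounding every element below by the cardinality avoids naming a minimum. Since n is in F, that
    bound is positive, so it also keeps 0 out of F. *)
Definition schreier_max (n : nat) (F : {fset nat}) : Prop :=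
  n \in F /\ forall x, x \in F -> #|` F| <= x <= n.

Definition neighbored_below (k n : nat) (F : {fset nat}) : bool :=
  [forall a : F, (val a != n) ==> [exists b : F,
     (val b != val a) && (`|(val a)%:Z - (val b)%:Z| <= k%:Z)%R]].

Definition E (k n : nat) : {fset {fset nat}} :=
  [fset F in fpowerset (interval1 n) |
     [&& n \in F, schreier F & neighbored_below k n F]]%fset.

Lemma linkedP k (F : {fset nat}) (a : F) :
  reflect (linked k F (val a))
    [exists b : F, (val b != val a) && (`|(val a)%:Z - (val b)%:Z| <= k%:Z)%R].
Proof.
apply: (iffP existsP) => [[b /andP[/eqP ba le_k]] | [b bF [ba ab_k ba_k]]].
  exists (val b); first exact: valP.
  by move: (val a) (val b) ba le_k => x y ? ?; split=> //; lia.
exists [` bF]%fset; apply/andP; split; first exact/eqP.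
by move: (val a) ab_k ba_k => x /=; lia.
Qed.

Lemma schreier_maxP n (F : {fset nat}) :
  reflect (schreier_max n F)
    [&& F \in fpowerset (interval1 n), n \in F & schreier F].
Proof.
rewrite fpowersetE; apply: (iffP and3P) => [[/fsubsetP Fn nF] | [nF bF]].
  move=> /existsP[[m mF] /andP[/andP[_ /forallP m_min] /= card_m]].
  split=> // x xF; have /= := m_min [` xF]%fset; have := Fn x xF.
  by rewrite !inE mem_iota; lia.
have cF : 0 < #|` F| by rewrite cardfs_gt0; apply/fset0Pn; exists n.
split=> //.
  by apply/fsubsetP=> x /bF; rewrite !inE mem_iota; lia.
have exF : exists i, i \in F by exists n.
case: (ex_minnP exF) => m mF m_min.
apply/existsP; exists [` mF]%fset; rewrite /is_min /= mF /=.
apply/andP; split; last by case/andP: (bF _ mF).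
by apply/forallP=> a; apply: m_min; exact: valP.
Qed.

Lemma mem_D k n F :
  F \in D k n <-> schreier_max n F /\ {in F, forall a, linked k F a}.
Proof.
rewrite !inE /= !andbA -[in X in X && _]andbA; split.
  case/andP=> /schreier_maxP sF /forallP nF; split=> // a aF.
  exact/(linkedP k [` aF]%fset).
case=> /schreier_maxP -> nF; apply/forallP=> a; apply/linkedP.
exact/nF/valP.
Qed.

Lemma mem_E k n F :
  F \in E k n <->
  schreier_max n F /\ {in F, forall a, a <> n -> linked k F a}.
Proof.
rewrite !inE /= !andbA -[in X in X && _]andbA; split.
  case/andP=> /schreier_maxP sF /forallP nF; split=> // a aF /eqP an.
  exact/(linkedP k [` aF]%fset)/(implyP (nF [` aF]%fset)).
case=> /schreier_maxP -> nF; apply/forallP=> a; apply/implyP=> /eqP an.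
by apply/linkedP/nF => //; exact: valP.
Qed.

(** * Shifting a set up and adjoining a new maximum *)

Definition push (n : nat) (G : {fset nat}) : {fset nat} :=
  (n |` [fset x.+1 | x in G])%fset.

Lemma mem_push n G x :
  reflect (x = n \/ exists2 y, y \in G & x = y.+1) (x \in push n G).
Proof.
rewrite /push !inE; apply: (iffP orP) => -[/eqP|]; first by left.
- by case/imfsetP=> y /= yG ->; right; exists y.
- by left.
by case=> y yG ->; right; apply: in_imfset.
Qed.

Lemma schreier_max_push m n G :
  m.+1 < n -> schreier_max m G -> schreier_max n (push n G).
Proof.
move=> mn [mG bG]; split; first by apply/mem_push; left.
have nG : n \notin [fset x.+1 | x in G]%fset.
  by apply/imfsetP=> -[y /= /bG]; lia.
have cG : #|` push n G| = #|` G|.+1.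
  by rewrite cardfsU1 nG card_imfset //= => x y [].
move=> x /mem_push; rewrite cG; have := bG _ mG.
by move=> ? [->|[y /bG ? ->]]; lia.
Qed.

(** Once F has two elements, the Schreier bound makes every element at least 2, so shifting down is
    injective and is undone by the successor. The witness m is the maximum of the shifted set G. *)
Lemma schreier_max_pop n F :
  schreier_max n F -> F <> [fset n]%fset ->
  exists m G, [/\ m.+1 < n, schreier_max m G & F = push n G].
Proof.
move=> [nF bF] neF; pose G := [fset x.-1 | x in (F `\ n)%fset]%fset.
have cF := cardfsD1 n F; rewrite nF in cF.
have [F1|/fset0Pn [z zF]] := eqVneq (F `\ n)%fset fset0.
  by case: neF; rewrite -(fsetD1K nF) F1 fsetU0.
have c2 : 1 < #|` F|.
  by rewrite cF ltnS cardfs_gt0; apply/fset0Pn; exists z.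
have memF x : x \in (F `\ n)%fset -> #|` F| <= x < n.
  by rewrite !inE => /andP[/eqP xn /bF]; lia.
have memG x : x \in G -> x.+1 \in (F `\ n)%fset.
  case/imfsetP=> y /= yF ->; have := memF _ yF.
  by move=> ?; rewrite prednK //; lia.
have cG : #|` G| = #|` (F `\ n)|%fset.
  rewrite card_in_imfset // => x y /= /memF ? /memF ?; lia.
have exG : exists i, i \in G by exists z.-1; apply: in_imfset.
have ubG i : i \in G -> i <= n by move=> /memG /memF; lia.
have [m mG mM] := ex_maxnP exG ubG.
exists m, G; split; first by have := memF _ (memG _ mG); lia.
  split=> // x xG; rewrite mM // andbT.
  have := memF _ (memG _ xG); lia.
apply/fsetP=> x; apply/idP/mem_push => [xF | [-> //|[y /memG yF ->]]].
  have [->|xn] := eqVneq x n; [by left | right].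
  have xF' : x \in (F `\ n)%fset by rewrite !inE xn.
  exists x.-1; first exact: in_imfset.
  by have := memF _ xF'; lia.
by move: yF; rewrite !inE => /andP[].
Qed.

(** Shifting keeps all distances, so only n can create a new link. If n is within k of x + 1 with x
    < m, then m is already within k of x; hence only x = m can gain from n. *)
Lemma linked_push k m n G :
  m.+1 < n -> schreier_max m G ->
  forall x, x \in G ->
  linked k (push n G) x.+1 <-> linked k G x \/ (x = m /\ n <= m.+1 + k).
Proof.
move=> mn [mG bG] x xG; split.
  case=> b /mem_push[->|[y yG ->]] [] ? ? ?.
    have [xm|/eqP xm] := eqVneq x m; [right; lia | left].
    by exists m => //; have := bG _ xG; split; lia.
  by left; exists y => //; split; lia.
case=> [[y yG [? ? ?]]|[-> ?]].
  by exists y.+1; [apply/mem_push; right; exists y | split; lia].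
by exists n; [apply/mem_push; left | split; lia].
Qed.

Lemma linked_push_max k m n G :
  m.+1 < n -> schreier_max m G ->
  linked k (push n G) n <-> n <= m.+1 + k.
Proof.
move=> mn [mG bG]; split=> [[b /mem_push[->|[y /bG yG ->]]]|nk].
- by case.
- by case; lia.
by exists m.+1; [apply/mem_push; right; exists m | split; lia].
Qed.

(** The element nearest to n is m + 1, so n requires a gap of at most k. That same link serves m +
    1, which is why m is exempt in [E k m]. *)
Lemma push_in_D k m n G :
  m.+1 < n -> schreier_max m G ->
  push n G \in D k n <-> n <= m.+1 + k /\ G \in E k m.
Proof.
move=> mn sG; have sP := schreier_max_push mn sG.
have lP := linked_push k mn sG; have lM := linked_push_max k mn sG.
split=> [/mem_D[_ lF]|[nk /mem_E[_ lG]]].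
  have nk : n <= m.+1 + k by apply/lM/lF/mem_push; left.
  split=> //; apply/mem_E; split=> // a aG am.
  have /(lP a aG)[//|[//]] : linked k (push n G) a.+1.
  by apply/lF/mem_push; right; exists a.
apply/mem_D; split=> // a /mem_push[->|[x xG ->]]; first exact/lM.
apply/lP => //; have [->|/eqP xm] := eqVneq x m; [by right | left].
exact: lG.
Qed.

(** If the gap exceeds k, then n is isolated, as [E] allows, and helps no other element, so G must
    satisfy the full condition. Otherwise n has the neighbour m + 1 and its exemption changes
    nothing. *)
Lemma push_in_E k m n G :
  m.+1 < n -> schreier_max m G ->
  push n G \in E k n <->
  push n G \in D k n \/ m.+1 + k < n /\ G \in D k m.
Proof.
move=> mn sG; have sP := schreier_max_push mn sG.
have lP := linked_push k mn sG; have lM := linked_push_max k mn sG.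
split=> [/mem_E[_ lF]|[/mem_D[_ lF]|[nk /mem_D[_ lG]]]].
- have [nk|nk] := leqP n (m.+1 + k).
    left; apply/mem_D; split=> // a aF.
    by have [->|/eqP] := eqVneq a n; [exact/lM | exact: lF].
  right; split=> //; apply/mem_D; split=> // a aG.
  have /(lP a aG)[//|[_]] : linked k (push n G) a.+1; last by lia.
  apply: lF; first by apply/mem_push; right; exists a.
  by case: sG => _ /(_ a aG); lia.
- by apply/mem_E; split=> // a aF _; exact: lF.
apply/mem_E; split=> // a /mem_push[->//|[x xG ->]] _.
by apply/lP => //; left; exact: lG.
Qed.

Lemma push_inj m1 m2 n G1 G2 :
  m1.+1 < n -> m2.+1 < n -> schreier_max m1 G1 -> schreier_max m2 G2 ->
  push n G1 = push n G2 -> m1 = m2 /\ G1 = G2.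
Proof.
move=> m1n m2n [mG1 bG1] [mG2 bG2] eqP.
have eqG : G1 = G2.
  apply/fsetP=> x; apply/idP/idP => xG.
    have : x.+1 \in push n G1 by apply/mem_push; right; exists x.
    rewrite eqP => /mem_push[|[y yG [->//]]].
    by have := bG1 _ xG; lia.
  have : x.+1 \in push n G2 by apply/mem_push; right; exists x.
  rewrite -eqP => /mem_push[|[y yG [->//]]].
  by have := bG2 _ xG; lia.
(* Both m1 and m2 are the maximum of the common set. *)
split=> //; subst G2; have := bG1 _ mG2; have := bG2 _ mG1; lia.
Qed.

(** * Counting through duplicate-free lists *)

Lemma size_pushes (A : nat -> {fset {fset nat}}) n s :
  size [seq push n G | m <- s, G <- A m] = \sum_(m <- s) #|` A m|.
Proof. by rewrite size_allpairs_dep sumnE big_map. Qed.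

Lemma uniq_pushes (A : nat -> {fset {fset nat}}) n s :
  uniq s -> {in s, forall m, m.+1 < n} ->
  (forall m G, G \in A m -> schreier_max m G) ->
  uniq [seq push n G | m <- s, G <- A m].
Proof.
move=> us sn sA; apply: allpairs_uniq_dep => // [m _|]; first exact: fset_uniq.
move=> _ _ /allpairsPdep[m1 [G1 [m1s G1A ->]]] /allpairsPdep[m2 [G2 [m2s G2A ->]]].
move=> /= /(push_inj (sn _ m1s) (sn _ m2s) (sA _ _ G1A) (sA _ _ G2A)).
by case=> -> ->.
Qed.

Lemma schreier_max1 n : 0 < n -> schreier_max n [fset n]%fset.
Proof.
move=> n_gt0; split; first by rewrite inE.
by move=> x; rewrite inE cardfs1 => /eqP->; rewrite n_gt0 leqnn.
Qed.

Lemma fset1_notin_D k n : [fset n]%fset \notin D k n.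
Proof.
apply/negP=> /mem_D[_ /(_ n)]; rewrite inE eqxx => /(_ isT)[b].
by rewrite inE => /eqP-> [].
Qed.

Definition sizeD k n : nat := #|` D k n|.
Definition sizeE k n : nat := #|` E k n|.

(** The summation bounds are the conditions [n <= m.+1 + k] and [m.+1 < n]; truncated subtraction
    expresses the first one exactly. *)
Lemma sizeD_eq k n : sizeD k n = \sum_(n - k.+1 <= m < n.-1) sizeE k m.
Proof.
rewrite /sizeD -(size_pushes (E k) n); apply/perm_size/uniq_perm.
- exact: fset_uniq.
- apply: uniq_pushes => [|m|m G /mem_E[]//]; first exact: iota_uniq.
  by rewrite mem_index_iota; lia.
move=> F; apply/idP/allpairsPdep => [FD | [m [G [ms GE ->]]]].
  have [sF _] := (mem_D k n F).1 FD.
  have [F1|m [G [mn sG eqF]]] := schreier_max_pop sF.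
    by move: FD; rewrite F1 (negPf (fset1_notin_D k n)).
  exists m, G; move: FD; rewrite eqF => /(push_in_D k mn sG)[nk GE].
  by split=> //; rewrite mem_index_iota; lia.
rewrite mem_index_iota in ms; have [sG _] := (mem_E k m G).1 GE.
by apply/(push_in_D k _ sG); [lia | split=> //; lia].
Qed.

(** The successor counts {n}, which is Schreier only for positive n. *)
Lemma sizeE_eq k n : 0 < n ->
  sizeE k n = (sizeD k n + \sum_(0 <= m < n - k.+1) sizeD k m).+1.
Proof.
move=> n_gt0; rewrite /sizeE -(size_pushes (D k) n) -size_cat.
set s := flatten _.
have sP F : reflect (exists m G, [/\ m < n - k.+1, G \in D k m & F = push n G])
                    (F \in s).
  apply: (iffP allpairsPdep) => -[m [G []]]; rewrite ?mem_index_iota => ms GD ->.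
    by exists m, G.
  by exists m, G; rewrite mem_index_iota.
have DS m G : G \in D k m -> schreier_max m G by case/mem_D.
rewrite -[RHS]/(size ([fset n]%fset :: _)); apply/perm_size/uniq_perm.
- exact: fset_uniq.
- rewrite /= mem_cat negb_or fset1_notin_D cat_uniq fset_uniq /=.
  apply/and3P; split.
  + apply/sP=> -[m [G [ms GD /fsetP /(_ m.+1)]]].
    have -> : m.+1 \in push n G.
      by apply/mem_push; right; exists m => //; case: (DS _ _ GD).
    by rewrite inE => /eqP; lia.
  (* Here n lies more than k above m + 1, so it has no neighbour. *)
  + apply/hasPn=> _ /sP[m [G [ms GD ->]]]; apply/negP.
    by move=> /(push_in_D k _ (DS _ _ GD))[]; lia.
  apply: uniq_pushes => //; first exact: iota_uniq.
  by move=> m; rewrite mem_index_iota; lia.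
move=> F; rewrite in_cons mem_cat; apply/idP/idP => [FE|].
  have [sF _] := (mem_E k n F).1 FE.
  have [//|/eqP F1] := eqVneq F [fset n]%fset.
  have [m [G [mn sG eqF]]] := schreier_max_pop sF F1.
  move: FE; rewrite eqF => /(push_in_E k mn sG)[-> //|[nk GD]] /=.
  by apply/orP; right; apply/sP; exists m, G; split=> //; lia.
case/or3P=> [/eqP->|/mem_D[sF lF]|/sP[m [G [ms GD ->]]]].
- apply/mem_E; split; first exact: schreier_max1.
  by move=> a; rewrite inE => /eqP.
- by apply/mem_E; split=> // a aF _; exact: lF.
by apply/(push_in_E k _ (DS _ _ GD)); [lia | right; split=> //; lia].
Qed.

(** * Eliminating [E] *)

Lemma sizeD0 k : sizeD k 0 = 0.
Proof. by rewrite sizeD_eq big_geq. Qed.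

Lemma sizeE0 k : sizeE k 0 = 0.
Proof.
apply/eqP; rewrite /sizeE cardfs_eq0; apply/eqP/fsetP=> F; rewrite in_fset0.
apply/negP=> /mem_E[[F0 /(_ 0 F0)]]; rewrite leqn0 cardfs_eq0 => /andP[/eqP F_0].
by move: F0; rewrite F_0 inE.
Qed.

(** The window of summation in [sizeD_eq] slides by one: one term enters at the top and one leaves
    at the bottom. *)
Lemma sizeD_succ k n : 0 < k -> 0 < n ->
  sizeD k n.+1 + sizeE k (n - k.+1) = sizeD k n + sizeE k n.-1.
Proof.
case: n => // n k_gt0 _; rewrite !sizeD_eq !subSS /=.
rewrite big_nat_recr /=; last by lia.
rewrite addnAC; congr (_ + _).
(* When n < k, both lower ends are truncated to 0 and no term leaves; the term on the left is then
   [sizeE k 0], which vanishes. *)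
have [kn|nk] := leqP k n.
  by rewrite subSn // addnC -big_ltn //; lia.
have [-> ->] : n.+1 - k = 0 /\ n - k = 0 by lia.
by rewrite sizeE0 addn0.
Qed.

(* Truncated subtraction is harmless here because [sizeD k 0 = 0]. *)
Lemma sum_sizeD_tail k N a :
  \sum_(0 <= m < N) sizeD k m =
  \sum_(0 <= m < N - a) sizeD k m + \sum_(1 <= j < a.+1) sizeD k (N - j).
Proof.
elim: a => [|a ->]; first by rewrite subn0 [in X in _ + X]big_geq ?addn0.
rewrite [in RHS]big_nat_recr //= addnA addnAC; congr (_ + _); rewrite subnS.
case: (N - a) => [|m] /=; first by rewrite big_geq // sizeD0.
by rewrite big_nat_recr.
Qed.

(** In this range no nonzero term leaves the window and the sum in [sizeE_eq] is empty, so adding 1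
    to each [sizeD] turns [sizeD_succ] into the Fibonacci recurrence. *)
Lemma sizeD_fib k n : 0 < k -> n <= k.+1 -> (sizeD k n.+1).+1 = fib n.+1.
Proof.
move=> k_gt0; elim/ltn_ind: n => -[|[|n]] IH nk.
- by rewrite sizeD_eq big_geq.
- by rewrite sizeD_eq (_ : 2 - k.+1 = 0) ?big_nat1 ?sizeE0 //; lia.
have := @sizeD_succ k n.+2 k_gt0 isT.
have -> : n.+2 - k.+1 = 0 by lia.
rewrite sizeE0 [n.+2.-1]/= sizeE_eq // (big_geq (m := 0)); last by lia.
rewrite -[fib n.+3]/(fib n.+2 + fib n.+1) -!IH; lia.
Qed.

(** Here k + p + 3 plays the role of n. The sums from the two uses of [sizeE_eq] run over m < p and
    m < p - k, so their difference is the last k terms. *)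
Lemma sizeD_rec k p : 0 < k ->
  sizeD k (k + p).+3 + sizeD k p.+1 =
  sizeD k (k + p).+2 + sizeD k (k + p).+1 +
  \sum_(1 <= j < k.+1) sizeD k (p - j).
Proof.
move=> k_gt0; have := @sizeD_succ k (k + p).+2 k_gt0 isT.
have -> : (k + p).+2 - k.+1 = p.+1 by lia.
rewrite /= !sizeE_eq // !subSS addKn (sum_sizeD_tail k p k).
by move: (\sum_(0 <= m < _) _) (\sum_(1 <= j < _) _) => x y; lia.
Qed.

(** * Transfer to integer indices *)

Local Open Scope ring_scope.

Lemma cardDE k n : cardD k n%:Z = (sizeD k n)%:Z.
Proof. by case: n => [|n] //=; rewrite sizeD0. Qed.

(** The zero convention at nonpositive indices agrees with truncation, because [D k 0] is empty. *)
Lemma cardD_sub k n m : cardD k (n%:Z - m%:Z) = (sizeD k (n - m)%N)%:Z.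
Proof.
have [mn|nm] := leqP m n; first by rewrite -cardDE; congr cardD; lia.
have -> : (n - m = 0)%N by lia.
rewrite sizeD0 /cardD; case E: (n%:Z - m%:Z) => [[|p]|p] //; lia.
Qed.

Theorem theorem1p3 (k : nat) (hk : (1 <= k)%N) :
  (forall n : nat, (1 <= n)%N -> (n <= k + 2)%N ->
     cardD k n%:Z = (fib n)%:Z - 1) /\
  (forall n : nat, (k + 3 <= n)%N ->
     cardD k n%:Z =
       cardD k (n%:Z - 1) + cardD k (n%:Z - 2) - cardD k (n%:Z - k%:Z - 2)
       + \sum_(k + 4 <= j < (2 * k + 3).+1) cardD k (n%:Z - j%:Z)).
Proof.
split=> [[//|n] _ nk|n kn].
  by rewrite cardDE -(@sizeD_fib k n hk); lia.
have -> : (n = (k + (n - k - 3)).+3)%N by lia.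
move: (n - k - 3)%N => p {n kn}.
have -> : (k + p).+3%:Z - k%:Z - 2 = (k + p).+3%:Z - k.+2%:Z by lia.
(* Shifting j by k + 3 turns n - j into p - j with 1 <= j <= k, as in [sizeD_rec]. *)
have -> : (k + 4 = 1 + (k + 3))%N by lia.
rewrite big_addn (_ : (2 * k + 3).+1 - (k + 3) = k.+1)%N; last by lia.
rewrite (cardD_sub _ _ 1) (cardD_sub _ _ 2) cardD_sub cardDE.
rewrite (eq_bigr (fun j => (sizeD k (p - j))%:Z)) => [|j _]; last first.
  by rewrite cardD_sub; do 2!congr (_ _); lia.
rewrite -(big_morph Posz PoszD (erefl 0%:Z)).
have := sizeD_rec p hk; rewrite !subSS !subn0 subSn ?leq_addr // addKn.
by move: (\sum_(_ <= _ < _) _)%N => x; lia.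
Qed.
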